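(* Let $n>1$ be an odd integer, and let $\zeta\in\mathbb C$ be a primitive $n$th root of unity. For $j,k=1,\ldots,n$ define $$a_{jk}=\begin{cases}(1+\zeta^{j-k})/(1-\zeta^{j-k})&\text{if}\ j\neq k,\\0&\text{if}\ j=k.\end{cases}$$ Then for every $x\in\mathbb C$, $$\det[x+a_{jk}]_{1\leqslant j,k\leqslant n-1}=(-1)^{\frac{n-1}{2}}\frac{((n-2)!!)^2}{n}.$$ In particular (the case $x=0$), $$\sum_{\tau\in D(n-1)}\mathrm{sign}(\tau)\prod_{j=1}^{n-1}\frac{1+\zeta^{j-\tau(j)}}{1-\zeta^{j-\tau(j)}}=(-1)^{\frac{n-1}{2}}\frac{((n-2)!!)^2}{n}.$$
   Context: $D(m)$ denotes the set of all derangements of $1,\ldots,m$, i.e. permutations $\tau$ of $\{1,\ldots,m\}$ with $\tau(j)\neq j$ for all $j$. For odd $m$, $m!!$ denotes the product of all odd positive integers up to $m$ (with $1!!=1$). $\mathrm{sign}(\tau)$ is the sign of the permutation $\tau$. *)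

(* Defs.v *)
From HB Require Import structures.
From mathcomp Require Import all_boot all_order all_algebra all_fingroup.
From mathcomp Require Import reals complex.

Set Implicit Arguments.
Unset Strict Implicit.
Unset Printing Implicit Defensive.

Import Order.TTheory GRing.Theory Num.Theory.
Local Open Scope ring_scope.

(* Used only for odd m, where it is m!!. *)
Definition odd_double_fact (m : nat) : nat :=
  (\prod_(1 <= i < m.+1 | odd i) i)%N.

Definition derangements (m : nat) : {set 'S_m} :=
  [set tau : 'S_m | [forall j, tau j != j]].

(* The exponent is an integer difference: it may be negative. *)
Definition root_quotient (F : fieldType) (zeta : F) (j k : nat) : F :=
  (1 + zeta ^ (j%:Z - k%:Z)) / (1 - zeta ^ (j%:Z - k%:Z)).

Definition a_entry (F : fieldType) (zeta : F) (j k : nat) : F :=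
  if j == k then 0 else root_quotient zeta j k.

(* Main.v *)
(** Write n = p + 1 and let A be the p x p matrix of the a_{jk}. The identity
    sum_{0<r<n} (n - 2r) q^r = n (1 + q)/(1 - q), for q^n = 1 and q <> 1,
    gives n A = W D W*, where W_{jr} = zeta^{jr} for 1 <= j, r <= p and
    D = diag(n - 2r). As W W* = n I - J, with J the all-ones matrix, has
    determinant n^{p-1}, we get det A = (1/n) prod_r (n - 2r). Finally A is
    skew-symmetric and, n being odd, invertible, so that
    det (A + x J) = det A (1 + x 1^T A^{-1} 1) = det A. *)

Require Import Defs.
From HB Require Import structures.
From mathcomp Require Import all_boot all_order all_algebra all_fingroup.
From mathcomp Require Import reals complex.
From mathcomp Require Import ring zify.

Set Implicit Arguments.
Unset Strict Implicit.
Unset Printing Implicit Defensive.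

Import Order.TTheory GRing.Theory Num.Theory.
Local Open Scope ring_scope.

(** Both products in [E] equal the block matrix with rows (1, v) and (-u, 1), so their determinants
    agree. *)
Lemma det_add1_col_row (R : comNzRingType) (m : nat)
    (u : 'cV[R]_m) (v : 'rV[R]_m) :
  \det (1%:M + u *m v) = 1 + (v *m u) 0 0.
Proof.
have E : block_mx 1%:M 0 (- u) 1%:M *m block_mx 1%:M v 0 (1%:M + u *m v)
       = block_mx (1%:M + v *m u) v 0 1%:M *m block_mx 1%:M 0 (- u) 1%:M.
  rewrite !mulmx_block !(mul1mx, mulmx1, mul0mx, mulmx0, addr0, add0r).
  by rewrite mulmxN mulNmx addrK addrCA addNr addr0.
have := congr1 determinant E.
rewrite !det_mulmx !det_lblock !det_ublock !det1 !mul1r !mulr1 => ->.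
by rewrite det_mx11 !mxE.
Qed.

(* The inverse of a skew-symmetric matrix is skew-symmetric, so its quadratic
   form vanishes on the all-ones vector. *)
Lemma det_skew_add_const (F : numFieldType) (m : nat) (B : 'M[F]_m) (x : F) :
  B^T = - B -> \det B != 0 -> \det (const_mx x + B) = \det B.
Proof.
move=> skewB detB.
have Bu : B \in unitmx by rewrite unitmxE unitfE.
pose u : 'cV[F]_m := const_mx 1; pose v : 'rV[F]_m := const_mx x.
have -> : const_mx x + B = B *m (1%:M + (invmx B *m u) *m v).
  rewrite mulmxDr mulmx1 -mulmxA mulKVmx // addrC; congr (_ + _).
  by apply/matrixP=> i j; rewrite !mxE big_ord1 !mxE mul1r.
rewrite det_mulmx det_add1_col_row.
suff -> : (v *m (invmx B *m u)) 0 0 = 0 by rewrite addr0 mulr1.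
have vE : v = x *: u^T by apply/matrixP=> i j; rewrite !mxE mulr1.
have skewV : (invmx B)^T = - invmx B.
  rewrite trmx_inv skewB -scaleN1r invmxZ ?invrN1 ?scaleN1r //.
  by rewrite -skewB unitmx_tr.
rewrite vE -scalemxAl mxE; set q := (_ *m _) 0 0.
suff /eqP : q = - q.
  by rewrite -addr_eq0 -mulr2n mulrn_eq0 /= => /eqP ->; rewrite mulr0.
rewrite {1}/q -[u^T *m _]trmxK mxE !trmx_mul trmxK skewV.
by rewrite mulmxN mulNmx -mulmxA mxE.
Qed.

(** Summation by parts. When q^m = 1 and q <> 1 the geometric sum vanishes, leaving sum r q^r = m/(q
    - 1). *)
Lemma mul_sub1_sum_mulrn (R : comNzRingType) (q : R) (m : nat) :
  (q - 1) * (\sum_(r < m) r%:R * q ^+ r) = m%:R * q ^+ m - q * \sum_(r < m) q ^+ r.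
Proof.
elim: m => [|m IH]; first by rewrite !big_ord0 mul0r !mulr0 subr0.
by rewrite !big_ord_recr /= !mulrDr IH exprS -natr1; ring.
Qed.

Lemma sum_expr_unity (F : fieldType) (q : F) (n : nat) :
  q ^+ n = 1 -> q != 1 -> \sum_(r < n) q ^+ r = 0.
Proof.
move=> qn q1; have /eqP := subrX1 q n.
by rewrite qn subrr eq_sym mulf_eq0 subr_eq0 (negbTE q1) => /eqP.
Qed.

(** With n = p + 1 and r from 1 to p, sum q^r = -1 (the term r = 0 is missing) and sum r q^r = n/(q
    - 1); finally -n - 2n/(q - 1) = n(1 + q)/(1 - q). *)
Lemma sum_weighted_expr_unity (F : fieldType) (q : F) (p : nat) :
  q ^+ p.+1 = 1 -> q != 1 ->
  \sum_(r < p) (p.+1%:R - (r.+1.*2)%:R) * q ^+ r.+1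
  = p.+1%:R * ((1 + q) / (1 - q)).
Proof.
move=> qn q1.
have q10 : 1 - q != 0 by rewrite subr_eq0 eq_sym.
have S0 := sum_expr_unity qn q1.
have S1 := mul_sub1_sum_mulrn q p.+1.
rewrite S0 qn mulr0 subr0 mulr1 in S1.
move: S0 S1; rewrite !big_ord_recl /= expr0 mul0r add0r /bump /=.
under eq_bigr do rewrite add1n.
under [X in _ * X]eq_bigr do rewrite add1n.
move=> S0 S1.
have -> : \sum_(r < p) (p.+1%:R - (r.+1.*2)%:R) * q ^+ r.+1
  = p.+1%:R * (\sum_(r < p) q ^+ r.+1) - 2 * \sum_(r < p) r.+1%:R * q ^+ r.+1.
  rewrite !mulr_sumr -sumrB; apply: eq_bigr => r _.
  by rewrite -muln2 natrM; ring.
have -> : \sum_(r < p) q ^+ r.+1 = -1.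
  by apply/eqP; rewrite -addr_eq0 addrC S0.
apply: (mulIf q10); rewrite -!mulrA mulVf // mulr1 mulrBl -mulrA.
rewrite [_ * (1 - q)]mulrC -[1 - q]opprB.
set S := \sum_(r < p) _ in S1 *.
have -> : 2 * S * - (q - 1) = - 2 * ((q - 1) * S) by ring.
by rewrite S1; ring.
Qed.

(** The weighted sum at q = 1; it accounts for the zero diagonal of A. *)
Lemma sum_subn_double (R : comNzRingType) (p : nat) :
  \sum_(r < p) (p.+1%:R - (r.+1.*2)%:R) = 0 :> R.
Proof.
rewrite sumrB sumr_const card_ord -natr_sum.
have -> : (\sum_(r < p) r.+1.*2 = p.+1 * p)%N.
  elim: p => [|p IH]; first by rewrite big_ord0 muln0.
  by rewrite big_ord_recr /= IH; lia.
by rewrite natrM mulr_natr subrr.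
Qed.

(** The factors are 2m-1, 2m-3, ..., -(2m-1). Each induction step peels off the two outermost ones,
    which are opposite. *)
Lemma prod_subn_double (R : comNzRingType) (m : nat) :
  \prod_(r < m.*2) ((m.*2.+1)%:R - (r.+1.*2)%:R)
  = (-1) ^+ m * (odd_double_fact (m.*2 - 1))%:R ^+ 2 :> R.
Proof.
elim: m => [|m IH].
  by rewrite big_ord0 /odd_double_fact big_geq // expr0 expr1n mulr1.
rewrite doubleS big_ord_recl big_ord_recr /= /bump /=.
under eq_bigr => i _.
  have -> : (m.*2.+3)%:R - ((1 + i).+1.*2)%:R = (m.*2.+1)%:R - (i.+1.*2)%:R :> R.
    rewrite add1n !doubleS -!natr1.
    by move: (m.*2)%:R (i.*2)%:R => a b; ring.
  over.
rewrite IH add1n /=.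
have -> : odd_double_fact (m.*2.+2 - 1) = (odd_double_fact (m.*2 - 1) * m.*2.+1)%N.
  rewrite /odd_double_fact !subSS subn0.
  rewrite [LHS]big_mkcond [LHS]big_nat_recr //= odd_double /=; congr (_ * _)%N.
  (* For m = 0 the subtraction [m.*2 - 1] truncates to 0; otherwise the ranges differ by one even
     index, which contributes 1. *)
  case: m {IH} => [|m]; first by rewrite !big_geq.
  rewrite -big_mkcond doubleS subSS subn0.
  by rewrite [LHS]big_mkcond [LHS]big_nat_recr //= odd_double /= muln1 -big_mkcond.
rewrite natrM [(-1) ^+ m.+1]exprS; move: (odd_double_fact _)%:R ((-1) ^+ m) => a b.
have -> : (m.*2.+2.*2)%:R = m.*2%:R * 2 + 4 :> R by rewrite -muln2 natrM -!natr1; ring.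
by rewrite -[(1.*2)%:R]/(2%:R) -!natr1; ring.
Qed.

Section RootMatrix.

Variables (F : numFieldType) (p : nat) (zeta : F).
Hypothesis zeta_prim : p.+1.-primitive_root zeta.

Let zeta_neq0 : zeta != 0.
Proof.
apply/eqP=> z0; have := prim_expr_order zeta_prim.
by rewrite z0 expr0n => /eqP; rewrite eq_sym oner_eq0.
Qed.

Let zeta_pow (j k : nat) : (zeta ^ (j%:Z - k%:Z)) ^+ p.+1 = 1.
Proof. by rewrite exprnP exprzAC -exprnP (prim_expr_order zeta_prim) exp1rz. Qed.

Let zeta_pow_neq1 (j k : 'I_p) : j != k -> zeta ^ (j.+1%:Z - k.+1%:Z) != 1.
Proof.
apply: contra => /eqP E.
have : zeta ^ j.+1%:Z == zeta ^ k.+1%:Z.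
  rewrite -[j.+1%:Z](subrK k.+1%:Z) expfzDr // E mul1r eqxx //.
rewrite -!exprnP (eq_prim_root_expr zeta_prim) /=.
by rewrite !modn_small ?ltnS // eqSS.
Qed.

Definition fourier_mx : 'M[F]_p := \matrix_(j, r) zeta ^+ (j.+1 * r.+1).
(** Inverse powers of [zeta] replace complex conjugates, so F needs no conjugation. *)
Definition fourier_conj_mx : 'M[F]_p := \matrix_(r, k) zeta ^- (k.+1 * r.+1).
Definition root_mx : 'M[F]_p := \matrix_(j, k) a_entry zeta j.+1 k.+1.

Let fourier_prod (j k r : 'I_p) :
  fourier_mx j r * fourier_conj_mx r k = (zeta ^ (j.+1%:Z - k.+1%:Z)) ^+ r.+1.
Proof.
by rewrite !mxE expfzDr // exprMn -exprnP -exprnN exprVn -!exprM.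
Qed.

(** Orthogonality of characters, with the trivial one r = 0 left out: this lowers every entry by 1.
    The factored form suits [det_add1_col_row]. *)
Lemma fourier_mulmx_conj :
  fourier_mx *m fourier_conj_mx
  = p.+1%:R *: (1%:M + const_mx (- p.+1%:R^-1) *m (const_mx 1 : 'rV_p)).
Proof.
apply/matrixP=> j k; rewrite mxE.
under eq_bigr do rewrite fourier_prod.
rewrite !mxE big_ord1 !mxE mulr1 mulrDr mulrN mulfV ?pnatr_eq0 //.
have [->|jk] := eqVneq j k.
  rewrite subrr expr0z; under eq_bigr do rewrite expr1n.
  by rewrite sumr_const card_ord mulr1 -natr1 addrK.
have := sum_expr_unity (zeta_pow j.+1 k.+1) (zeta_pow_neq1 jk).
rewrite big_ord_recl expr0 mulr0 add0r => /eqP; rewrite addrC addr_eq0 => /eqP <-.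
by apply: eq_bigr => i _.
Qed.

Lemma root_mx_fourier :
  p.+1%:R *: root_mx
  = fourier_mx *m diag_mx (\row_r (p.+1%:R - (r.+1.*2)%:R)) *m fourier_conj_mx.
Proof.
apply/matrixP=> j k; rewrite mxE mul_mx_diag [RHS]mxE.
under eq_bigr => r _.
  rewrite mxE [X in _ * X * _]mxE mulrAC fourier_prod mulrC; over.
rewrite mxE /a_entry eqSS; have [->|jk] := eqVneq j k.
  rewrite eqxx subrr expr0z mulr0; under eq_bigr do rewrite expr1n mulr1.
  by rewrite sum_subn_double.
have -> : (j == k :> nat) = false by apply: negbTE.
by rewrite sum_weighted_expr_unity ?zeta_pow ?zeta_pow_neq1.
Qed.

Lemma det_root_mx :
  \det root_mx = (\prod_(r < p) (p.+1%:R - (r.+1.*2)%:R)) / p.+1%:R.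
Proof.
have n0 : p.+1%:R != 0 :> F by rewrite pnatr_eq0.
apply: (mulfI (expf_neq0 p n0)).
rewrite -detZ root_mx_fourier !det_mulmx mulrAC -det_mulmx fourier_mulmx_conj.
rewrite detZ det_add1_col_row det_diag -mulrA; congr (_ * _).
rewrite mulrC; congr (_ * _); first by apply: eq_bigr => r _; rewrite mxE.
rewrite mxE; under eq_bigr do rewrite !mxE mul1r.
rewrite sumr_const card_ord mulNrn -[_ *+ p]mulr_natl; apply: (mulIf n0).
by rewrite mulrBl mul1r -mulrA mulVf // -natr1 mulr1 addrAC subrr add0r.
Qed.

(** Swapping j and k inverts q, and (1 + q)/(1 - q) changes sign under q -> 1/q. *)
Lemma trmx_root_mx : root_mx^T = - root_mx.
Proof.
apply/matrixP=> j k; rewrite !mxE /a_entry !eqSS eq_sym.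
have [_|jk] := eqVneq (j : nat) k; first by rewrite oppr0.
have q1 := zeta_pow_neq1 jk.
rewrite /root_quotient -[k.+1%:Z - _]opprB -invr_expz.
set q := zeta ^ _ in q1 *.
have q0 : q != 0 by rewrite expfz_neq0.
have q2 : 1 - q != 0 by rewrite subr_eq0 eq_sym.
have q3 : q - 1 != 0 by rewrite subr_eq0.
by field; rewrite ?q0 ?q2 ?q3.
Qed.

(** In the Leibniz expansion a fixed point of tau selects a zero diagonal entry. *)
Lemma sum_derangements_root_quotient :
  \sum_(tau in derangements p)
     (-1) ^+ odd_perm tau * \prod_(j < p) root_quotient zeta j.+1 (tau j).+1
  = \det root_mx.
Proof.
rewrite /determinant [RHS](bigID (fun tau => tau \in derangements p)) /=.
rewrite [X in _ = _ + X]big1 ?addr0 => [|tau].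
  apply: eq_bigr => tau; rewrite inE => /forallP tauD.
  congr (_ * _); apply: eq_bigr => j _; rewrite mxE /a_entry eqSS eq_sym.
  by rewrite ifN // tauD.
rewrite inE negb_forall => /existsP[j]; rewrite negbK => /eqP tauj.
by rewrite (bigD1 j) //= mxE tauj /a_entry eqxx mul0r mulr0.
Qed.

End RootMatrix.

(* An ordinal i : 'I_(n - 1) stands for the index i.+1 in {1, ..., n - 1}. *)
Theorem theorem1p1 (R : realType) (n : nat) (zeta : R[i])
    (n_gt1 : (1 < n)%N) (n_odd : odd n) (zeta_prim : n.-primitive_root zeta) :
  (forall x : R[i],
     \det (\matrix_(j < n - 1, k < n - 1) (x + a_entry zeta j.+1 k.+1))
     = (-1) ^+ ((n - 1) %/ 2) * ((odd_double_fact (n - 2))%:R ^+ 2 / n%:R))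
  /\
  \sum_(tau in derangements (n - 1))
     (-1) ^+ odd_perm tau *
     \prod_(j < n - 1) root_quotient zeta j.+1 (tau j).+1
  = (-1) ^+ ((n - 1) %/ 2) * ((odd_double_fact (n - 2))%:R ^+ 2 / n%:R)
    :> R[i].
Proof.
have [m nE] : exists m, n = m.*2.+1.
  by exists n./2; rewrite -[LHS]odd_double_half n_odd.
subst n; rewrite [in odd_double_fact _]subSS [in (_ %/ _)%N]subn1 /= divn2 doubleK subn1 /=.
have detE := det_root_mx zeta_prim.
rewrite prod_subn_double -mulrA in detE.
split=> [x|]; last by rewrite sum_derangements_root_quotient.
rewrite -detE -(@det_skew_add_const _ _ _ x (trmx_root_mx zeta_prim)).
  by congr (\det _); apply/matrixP=> j k; rewrite !mxE.
(* Invertibility of A, as [det_skew_add_const] demands: the double factorial is a product of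
   positive integers. *)
rewrite detE mulf_neq0 ?signr_eq0 // mulf_neq0 ?invr_eq0 ?pnatr_eq0 //.
rewrite expf_neq0 // pnatr_eq0 -lt0n /odd_double_fact.
by apply: prodn_cond_gt0 => -[].
Qed.
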